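(* Let $V$ and $V'$ be topological vector spaces over the discrete field $k$ with linear topology, such that $V$ has the $\kappa$-codimension topology, where $\kappa$ is a cardinal with $\kappa=1$ or $\kappa\geqslant\aleph_0$. If $\dim V' < \kappa$, then $\mathrm{CHom}(V,V') = \mathrm{Hom}(V,V')$.
   Context: Fix a field $k$ with the discrete topology; all vector spaces are over $k$. A topological vector space is a $k$-vector space with a topology for which addition and scalar multiplication are continuous (no Hausdorff assumption). It has linear topology if the neighborhood filter of $0$ is generated by open vector subspaces. For a cardinal $\kappa$ with $\kappa=1$ or $\kappa\geqslant\aleph_0$, the $\kappa$-codimension topology on $V$ is the vector space topology whose neighborhood filter of $0$ is generated by the set of all vector subspaces $W$ of $V$ with $\mathrm{codim}\, W=\dim V/W<\kappa$. $\mathrm{Hom}(V,V')$ is the set of all linear maps $V\to V'$, and $\mathrm{CHom}(V,V')$ the subset of continuous linear maps. *)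

(* Defs.v *)
From HB Require Import structures.
From mathcomp Require Import all_boot all_algebra.
From mathcomp Require Import boolp classical_sets functions cardinality filter.
From mathcomp Require Import topology.

Set Implicit Arguments.
Unset Strict Implicit.
Unset Printing Implicit Defensive.

Import GRing.Theory Quotient.

Local Open Scope classical_set_scope.
Local Open Scope card_scope.
Local Open Scope ring_scope.
Local Open Scope quotient_scope.

(* The library's topologicalLmodType only allows scalars in a numDomainType
   with its norm topology, hence a separate structure for an arbitrary field
   with the discrete topology. *)
HB.mixin Record isDiscreteTvs (k : fieldType) V
    & Topological V & GRing.Lmodule k V := {
  dtvs_add_continuous : continuous (fun z : V * V => z.1 + z.2) ;
  dtvs_scale_continuous :
    continuous (fun z : discrete_topology k * V => (z.1 : k) *: z.2)
}.

#[short(type="discreteTvsType")]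
HB.structure Definition DiscreteTvs (k : fieldType) :=
  {V of Topological V & GRing.Lmodule k V & isDiscreteTvs k V}.

Section Dimension.
Context {k : fieldType} {E : lmodType k}.
Implicit Type B : set E.

Definition linearly_independent B := forall (s : seq E) (a : E -> k),
  uniq s -> [set` s] `<=` B -> \sum_(v <- s) a v *: v = 0 ->
  forall v, v \in s -> a v = 0.

Definition linear_span B : set E := [set x | exists (s : seq E) (a : E -> k),
  [set` s] `<=` B /\ x = \sum_(v <- s) a v *: v].

Definition is_basis B := linearly_independent B /\ linear_span B = setT.

End Dimension.

(* Cardinals are represented by sets, compared with #<= and #=. *)
Definition card_lt {T U : Type} (A : set T) (B : set U) : Prop :=
  A #<= B /\ ~ (A #= B).

(* dim E < kappa; all bases of E are equipotent, so any one of them may serve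
   to measure the dimension. *)
Definition dim_lt {k : fieldType} (E : lmodType k) {K : Type} (kappa : set K) :=
  exists2 B : set E, is_basis B & card_lt B kappa.

(* The library's quotient of a zmodType by a subgroup, for a subgroup that is
   stable under scaling, with its vector space structure. *)
Section QuotientSpace.
Context {k : fieldType} {V : lmodType k}.
Variable W : submodClosed V.

(* A submodClosed is not canonically a zmodClosed. *)
Definition submod_pred : {pred V} := fun x => x \in W.

Fact submod_pred_zmod_closed : zmod_closed submod_pred.
Proof. exact: GRing.submod_closedB (submodClosedP W). Qed.

HB.instance Definition _ :=
  GRing.isZmodClosed.Build V submod_pred submod_pred_zmod_closed.

Definition quotient_space : Type := {quot submod_pred}.

HB.instance Definition _ := GRing.Zmodule.on quotient_space.

Local Notation Q := {quot submod_pred}.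

Definition quotient_scale (a : k) (x : quotient_space) : quotient_space :=
  \pi_Q (a *: repr (x : Q)).

Lemma eq_piE (x y : V) : (\pi_Q x == \pi_Q y) = (x - y \in W).
Proof. by rewrite -Quotient.idealrBE. Qed.

Lemma pi_scale a (x : V) : quotient_scale a (\pi_Q x) = \pi_Q (a *: x).
Proof.
by apply/eqP; rewrite eq_piE -scalerBr rpredZ // -eq_piE reprK.
Qed.

Lemma quotient_scaleA a b x :
  quotient_scale a (quotient_scale b x) = quotient_scale (a * b) x.
Proof. by rewrite -[x](@reprK _ Q) !pi_scale scalerA. Qed.

Lemma quotient_scale1 : left_id 1 quotient_scale.
Proof. by move=> x; rewrite -[x](@reprK _ Q) pi_scale scale1r. Qed.

Lemma quotient_scaleDr : right_distributive quotient_scale +%R.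
Proof.
move=> a x y; rewrite -[x](@reprK _ Q) -[y](@reprK _ Q).
by rewrite -raddfD !pi_scale scalerDr raddfD.
Qed.

Lemma quotient_scaleDl x : {morph quotient_scale^~ x : a b / a + b}.
Proof.
by move=> a b; rewrite -[x](@reprK _ Q) !pi_scale scalerDl raddfD.
Qed.

HB.instance Definition _ := GRing.Zmodule_isLmodule.Build k quotient_space
  quotient_scaleA quotient_scale1 quotient_scaleDr quotient_scaleDl.

End QuotientSpace.

Definition codim_lt {k : fieldType} {V : lmodType k} (W : submodClosed V)
    {K : Type} (kappa : set K) :=
  dim_lt (quotient_space W) kappa.

Definition filter_generated_by {T : Type} (G : set_system T) : set_system T :=
  smallest Filter G.

Definition linear_topology {k : fieldType} (V : discreteTvsType k) :=
  nbhs (0 : V) = filter_generated_by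
    [set [set x | x \in W] | W in [set W : submodClosed V |
                                    open [set x : V | x \in W]]].

Definition codim_topology {k : fieldType} (V : discreteTvsType k)
    {K : Type} (kappa : set K) :=
  nbhs (0 : V) = filter_generated_by
    [set [set x | x \in W] | W in [set W : submodClosed V | codim_lt W kappa]].

Definition LinHom {k : fieldType} (V V' : lmodType k) : set (V -> V') :=
  [set f | linear f].
Arguments LinHom {k} V V' _.

Definition CLinHom {k : fieldType} (V V' : discreteTvsType k) : set (V -> V') :=
  [set f | LinHom V V' f /\ continuous f].
Arguments CLinHom {k} V V' _.

(* Main.v *)
(** If [W] is the preimage of an open subspace under a linear map [f : V -> V'],
    then [V / W] is also a quotient of the image of [f], so the codimension of
    [W] is at most [dim V'].  A well-ordering of a spanning set of [V'] proves
    this for finite and infinite dimensions at once, with no exchange argument: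
    for each leading term of a vector of the image of [f] that is not a leading
    term of a vector of the image of [W], choose a vector of [V] that maps to
    one with this leading term; the classes of these vectors form a basis of
    [V / W]. *)
Require Import Defs.
From HB Require Import structures.
From mathcomp Require Import all_boot all_algebra.
From mathcomp Require Import boolp classical_sets cardinality topology.
From mathcomp Require Import wochoice.

Set Implicit Arguments.
Unset Strict Implicit.
Unset Printing Implicit Defensive.

Import GRing.Theory Quotient.

Local Open Scope classical_set_scope.
Local Open Scope ring_scope.

Lemma seq_has_max (T : eqType) (R : rel T) (s : seq T) :
    reflexive R -> transitive R -> total R -> s != [::] ->
  exists2 m, m \in s & {in s, forall x, R x m}.
Proof.
move=> Rxx Rtr Rtot; elim: s => [//|x s IHs] _.
have [-> | /IHs[m ms mP]] := eqVneq s [::].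
  by exists x => [|y]; rewrite inE // => /eqP->.
case/orP: (Rtot x m) => [xm | mx].
  by exists m => [|y]; rewrite inE ?ms ?orbT // => /predU1P[->|/mP].
exists x => [|y]; rewrite inE ?eqxx // => /predU1P[->//|/mP ym].
exact: Rtr ym mx.
Qed.

(** * Linear spans as subspaces *)

Section LinearSpan.
Context {k : fieldType} {E : lmodType k}.
Implicit Types X Y : set E.

(** A vector listed [n] times contributes [n] times its coefficient, so duplicates merge once
    coefficients are multiplied by multiplicities. *)
Lemma linear_span_uniq X x : linear_span X x ->
  exists (s : seq E) (a : E -> k),
    [/\ uniq s, [set` s] `<=` X & x = \sum_(v <- s) a v *: v].
Proof.
move=> [s [a [sX ->]]].
exists (undup s), (fun v => a v *+ count_mem v s); split.
- exact: undup_uniq.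
- by move=> v /=; rewrite mem_undup => /sX.
rewrite -[LHS]big_undup_iterop_count; apply: eq_bigr => v _.
by rewrite -scalerMnl.
Qed.

Lemma linear_span_linear X x y (c : k) :
  linear_span X x -> linear_span X y -> linear_span X (c *: x + y).
Proof.
move=> /linear_span_uniq[s [a [us sX ->]]] /linear_span_uniq[t [b [ut tX ->]]].
exists (undup (s ++ t)), (fun v => (if v \in s then c * a v else 0)
                                 + (if v \in t then b v else 0)); split.
  by move=> v /=; rewrite mem_undup mem_cat => /orP[/sX|/tX].
(* Extension by zero coefficients brings both sums to one common duplicate-free list, where they add
   termwise. *)
have sumE (r : seq E) (e : E -> k) : uniq r -> {subset r <= s ++ t} ->
    \sum_(v <- r) e v *: v =
    \sum_(v <- undup (s ++ t)) (if v \in r then e v else 0) *: v.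
  move=> ur rst.
  rewrite [RHS](bigID (mem r)) /= [X in _ + X]big1 ?addr0; last first.
    by move=> v /negbTE->; rewrite scale0r.
  rewrite [LHS](perm_big [seq v <- undup (s ++ t) | v \in r]).
    by rewrite big_filter; apply: eq_bigr => v ->.
  apply: uniq_perm => [//||v]; first by rewrite filter_uniq ?undup_uniq.
  rewrite mem_filter mem_undup.
  by case: (boolP (v \in r)) => //= /rst->.
rewrite scaler_sumr (eq_bigr (fun v => (c * a v) *: v)); last first.
  by move=> v _; rewrite scalerA.
rewrite (sumE s) ?(sumE t) //; first last.
- by move=> v; rewrite mem_cat => ->.
- by move=> v; rewrite mem_cat => ->; rewrite orbT.
by rewrite -big_split; apply: eq_bigr => v _; rewrite scalerDl.
Qed.

Definition span_pred X : {pred E} := fun x => `[< linear_span X x >].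

Lemma span_predP X x : reflect (linear_span X x) (x \in span_pred X).
Proof. exact: asboolP. Qed.

Fact span_submod_closed X : GRing.submod_closed (span_pred X).
Proof.
split; first by apply/span_predP; exists [::], (fun=> 0); rewrite big_nil.
move=> c x y /span_predP xX /span_predP yX; apply/span_predP.
exact: linear_span_linear.
Qed.

HB.instance Definition _ X :=
  GRing.isSubmodClosed.Build k E (span_pred X) (span_submod_closed X).

Lemma mem_span X x : X x -> x \in span_pred X.
Proof.
move=> Xx; apply/span_predP; exists [:: x], (fun=> 1); split.
  by move=> y /=; rewrite inE => /eqP->.
by rewrite big_seq1 scale1r.
Qed.

Lemma span_subset X Y : X `<=` Y -> {subset span_pred X <= span_pred Y}.
Proof.
move=> XY x /span_predP[s [a [sX ->]]]; apply/span_predP.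
by exists s, a; split=> // v /sX/XY.
Qed.

Lemma span_insert X b x : x \in span_pred (b |` X) ->
  exists c : k, x - c *: b \in span_pred X.
Proof.
move=> /span_predP[s [a [sX ->]]].
exists (\sum_(v <- s | v == b) a v).
rewrite scaler_suml (bigID (pred1 b)) /= addrAC -sumrB big1 ?add0r.
  rewrite big_seq_cond; apply: rpred_sum => v /andP[/sX vX vb].
  by apply/rpredZ/mem_span; case: vX => // vE; rewrite vE eqxx in vb.
by move=> v /eqP->; rewrite subrr.
Qed.

End LinearSpan.

(** * A basis of a subquotient from leading terms *)

Section SubquotientDimension.
Context {k : fieldType} {V V' Q : lmodType k}.
Variables (f : {linear V -> V'}) (p : {linear V -> Q}) (S : set V').
Hypothesis p_surj : forall q, exists v, p v = q.
Hypothesis ker_fp : forall v, f v = 0 -> p v = 0.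
Hypothesis spanS : linear_span S = setT.

Variable R : rel V'.
Hypothesis Rxx : reflexive R.
Hypothesis Rtr : transitive R.
Hypothesis Ranti : antisymmetric R.
Hypothesis Rtot : total R.
Hypothesis Rmin : forall A : set V', A !=set0 ->
  exists2 b, A b & forall y, A y -> R b y.

Let below b : set V' := [set y | [/\ S y, R y b & y != b]].

(* The leading term of [f v] is [b], with coefficient [1]. *)
Let leads b v := f v - b \in span_pred (below b).

(** Leading terms attained on [V] but not on the kernel of [p]. If [b] lies in the span of
    [below b], then the zero vector satisfies [leads b], so [b] is discarded: redundancy in [S] does
    no harm. *)
Let T : set V' := [set b | [/\ S b, exists v, leads b v &
  ~ exists2 v, p v = 0 & leads b v]].

Variable u : V' -> V.
Hypothesis uP : forall b, T b -> leads b (u b).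

Let B : set Q := [set p (u b) | b in T].

(** In a nontrivial relation, take the largest leading term with nonzero coefficient. The same
    combination formed in [V] is killed by [p] and keeps this leading term, which membership in [T]
    forbids. *)
Lemma leads_classes_independent : linearly_independent B.
Proof.
move=> s a us sB sum0 q1 q1s; apply: contrapT => /eqP aq1.
(* [t] recovers an index in [T] from each class; its value [0] outside [B] is a dummy. *)
have [t tP] : {t : Q -> V' & forall q, B q -> T (t q) /\ p (u (t q)) = q}.
  apply: (choice (P := fun q b => B q -> T b /\ p (u b) = q)) => q.
  have [[b Tb <-]|nBq] := pselect (B q); first by exists b.
  by exists 0.
have [q0] : exists2 q0, q0 \in [seq q <- s | a q != 0] &
    {in [seq q <- s | a q != 0], forall q, R (t q) (t q0)}.
  apply: seq_has_max (fun q q' => R (t q) (t q')) _ _ _ _ _.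
  - by move=> q; apply: Rxx.
  - by move=> q q' q''; apply: Rtr.
  - by move=> q q'; apply: Rtot.
  - by apply/eqP => s0; move: (in_nil q1); rewrite -s0 mem_filter aq1 q1s.
rewrite mem_filter => /andP[aq0 q0s] q0max.
have [[_ _ noker] puq0] := tP _ (sB _ q0s); apply: noker.
(* Division by [a q0] gives the leading coefficient [1] that [leads] demands. *)
exists (\sum_(q <- s) ((a q0)^-1 * a q) *: u (t q)).
  transitivity ((a q0)^-1 *: \sum_(q <- s) a q *: q); last first.
    by rewrite sum0 scaler0.
  rewrite linear_sum scaler_sumr big_seq [RHS]big_seq.
  apply: eq_bigr => q /sB/tP[_ puq].
  by rewrite linearZ /= puq scalerA.
rewrite /leads linear_sum (bigD1_seq q0) //= mulVf // scale1r addrAC.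
apply: rpredD; first by apply/uP; case: (tP _ (sB _ q0s)).
rewrite big_seq_cond; apply: rpred_sum => q /andP[qs qq0].
have [-> | aq] := eqVneq (a q) 0.
  by rewrite mulr0 scale0r linear0 rpred0.
have [Tq puq] := tP _ (sB _ qs).
have Rq : R (t q) (t q0) by apply: q0max; rewrite mem_filter aq.
have tqq0 : t q != t q0.
  by apply: contra_neq qq0 => tE; rewrite -puq -puq0 tE.
rewrite linearZ /=; apply: rpredZ.
(* [f (u (t q))] splits into a part below [t q] and [t q] itself, both in the span of
   [below (t q0)]. *)
rewrite -[f _](subrK (t q)); apply: rpredD.
  apply: (@span_subset _ _ (below (t q))) (uP Tq) => y [Sy Ry yq].
  split=> //; first exact: Rtr Ry Rq.
  apply: contra_neq tqq0 => yE; apply: Ranti.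
  by rewrite Rq -yE Ry.
by apply: mem_span; split=> //; case: Tq.
Qed.

(** Minimal counterexample: at the least bad [b], subtracting a vector with leading term [b] and
    class in the span of [B] leaves only terms below [b]. *)
Lemma leads_classes_span : linear_span B = setT.
Proof.
pose upto b : set V' := [set y | S y /\ R y b].
pose bad : set V' :=
  [set b | exists2 v, f v \in span_pred (upto b) & p v \notin span_pred B].
(* The largest vector of an expansion of [f v] is bad; an empty expansion is excluded by
   [ker_fp]. *)
have bad_below X v : X `<=` S -> f v \in span_pred X ->
    p v \notin span_pred B -> exists2 b, X b & bad b.
  move=> XS /span_predP[s [a [sX fvE]]] pvB.
  have [s0 | sn0] := eqVneq s [::].
    by rewrite ker_fp ?rpred0 // in pvB; rewrite fvE s0 big_nil.
  have [b bs bmax] := seq_has_max Rxx Rtr Rtot sn0.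
  exists b; first exact: sX.
  exists v => //; apply/span_predP; exists s, a; split=> // y ys.
  by split; [apply/XS/sX | apply: bmax].
apply/seteqP; split=> // q _; have [v <-] := p_surj q.
apply/span_predP; apply: contrapT => /negP pvB.
have [b0 _ bad_b0] : exists2 b, S b & bad b.
  by apply: bad_below pvB => //; apply/span_predP; rewrite spanS.
have [b [w fw pw] bmin] := Rmin (ex_intro _ b0 bad_b0).
have not_below x : f x \in span_pred (below b) -> p x \in span_pred B.
  move=> fx; apply: contraT => px.
  have [|y [_ Ryb /eqP yb] /bmin Rby] := bad_below _ _ _ fx px.
    by move=> y [].
  by case: yb; apply: Ranti; rewrite Ryb.
(* [bad] ranges over all of [V'], so [b] may lie outside [S]; then [upto b] and [below b]
   coincide. *)
have [Sb | nSb] := pselect (S b); last first.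
  case/negP: pw; apply: not_below; apply: span_subset fw => y [Sy Ry].
  by split=> //; apply/eqP => yE; apply: nSb; rewrite -yE.
have [c fwc] : exists c : k, f w - c *: b \in span_pred (below b).
  apply: span_insert; apply: span_subset fw => y [Sy Ry].
  by have [-> | yb] := eqVneq y b; [left | right].
have [c0 | cn0] := eqVneq c 0.
  by case/negP: pw; apply: not_below; rewrite c0 scale0r subr0 in fwc.
(* Either the kernel of [p] supplies [x], or [b] is in [T], witnessed by [w] divided by [c], and
   [u b] serves. *)
have [x lx px] : exists2 x, leads b x & p x \in span_pred B.
  have [[x px lx] | noker] := pselect (exists2 x, p x = 0 & leads b x).
    by exists x; rewrite // px rpred0.
  have Tb : T b.
    split=> //; exists (c^-1 *: w); rewrite /leads linearZ /=.
    have -> : c^-1 *: f w - b = c^-1 *: (f w - c *: b).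
      by rewrite scalerBr scalerA mulVf // scale1r.
    exact: rpredZ.
  by exists (u b); [apply: uP | apply: mem_span; exists b].
case/negP: pw; rewrite -[w](subrK (c *: x)) linearD.
apply: rpredD; last by rewrite linearZ /= rpredZ.
apply: not_below; rewrite linearB (linearZ_LR f).
(* The terms [c *: b] cancel, so [w - c *: x] is mapped into the span of [below b]. *)
have -> : f w - c *: f x = (f w - c *: b) - c *: (f x - b).
  by rewrite scalerBr opprB addrA subrK.
by apply: rpredB => //; apply: rpredZ.
Qed.

End SubquotientDimension.

(** After a well-ordering of [V'], the basis is the image of a subset of [S], which bounds its
    cardinality. *)
Lemma subquotient_basis (k : fieldType) (V V' Q : lmodType k)
    (f : {linear V -> V'}) (p : {linear V -> Q}) (S : set V') :
    (forall q, exists v, p v = q) -> (forall v, f v = 0 -> p v = 0) ->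
    linear_span S = setT ->
  exists2 B : set Q, is_basis B & (B #<= S)%card.
Proof.
move=> p_surj ker_fp spanS; have [R Rwo] := well_ordering_principle V'.
have Rch : wo_chain R predT by move=> A _; apply: Rwo.
have Rtot : total R by move=> x y; apply: (wo_chainW Rch).
have Rxx : reflexive R by move=> x; apply: (wo_chain_reflexive Rch).
have Ranti : antisymmetric R.
  by move=> x y; apply: (wo_chain_antisymmetric Rch).
have Rmin (A : set V') : A !=set0 -> exists2 b, A b & forall y, A y -> R b y.
  move=> [x Ax]; have [|b [[bA bmin] _]] := Rwo (mem A).
    by exists x; apply/mem_set.
  by exists b => [|y Ay]; [apply/set_mem | apply/bmin/mem_set].
have Rtr : transitive R.
  move=> y x z Rxy Ryz.
  (* Transitivity is read off the least element of a three-element set. *)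
  have [|b bA bmin] := Rmin [set x; y; z]; first by exists x; left; left.
  have [bx by_ bz] : [/\ R b x, R b y & R b z].
    by split; apply: bmin; [left; left | left; right | right].
  case: bA => [[bE|bE]|bE]; rewrite bE in bx by_ bz => //.
    by rewrite (Ranti x y) // Rxy bx.
  by rewrite -(Ranti y z) ?Ryz ?by_.
pose below b : set V' := [set y | [/\ S y, R y b & y != b]].
pose leads b v := f v - b \in span_pred (below b).
have [u uP] : {u : V' -> V & forall b, (exists v, leads b v) ->
    leads b (u b)}.
  apply: (choice (P := fun b v => (exists v, leads b v) -> leads b v)) => b.
  by have [[v lv]|nl] := pselect (exists v, leads b v); [exists v | exists 0].
(* The witness, fixed by unification below, is the set of classes of the chosen [u b]. *)
eexists.
  split.
    apply: (@leads_classes_independent k V V' Q f p S R _ _ _ _ u) => //.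
    by move=> b [_ /uP].
  by apply: leads_classes_span => // b [_ /uP].
apply: card_le_trans (card_image_le _ _) _.
by apply: subset_card_le => b [].
Qed.

(** * Quotient maps, preimages and codimension *)

Section QuotientProjection.
Context {k : fieldType} {V : lmodType k}.
Variable W : submodClosed V.

Definition quotient_proj (x : V) : quotient_space W :=
  (\pi_({quot (submod_pred W)}) x)%qT.

Fact quotient_proj_linear : linear quotient_proj.
Proof.
move=> a x y; rewrite /quotient_proj raddfD; congr (_ + _).
exact/esym/pi_scale.
Qed.

HB.instance Definition _ :=
  GRing.isLinear.Build k V (quotient_space W) _ quotient_proj
    quotient_proj_linear.

Lemma quotient_proj_surj q : exists v, quotient_proj v = q.
Proof.
by exists (repr (q : {quot (submod_pred W)})%qT); apply: reprK.
Qed.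

Lemma quotient_proj_eq0 x : x \in W -> quotient_proj x = 0.
Proof.
move=> xW; rewrite -(linear0 quotient_proj); apply/eqP.
by rewrite [_ == _]eq_piE subr0.
Qed.

End QuotientProjection.

Section LinearPreimage.
Context {k : fieldType} {V V' : lmodType k}.
Variables (f : {linear V -> V'}) (W : submodClosed V').

Definition linear_preimage : {pred V} := fun x => f x \in W.

Lemma mem_linear_preimage x : (x \in linear_preimage) = (f x \in W).
Proof. by []. Qed.

Fact linear_preimage_submod_closed : GRing.submod_closed linear_preimage.
Proof.
split=> [|a x y]; rewrite !mem_linear_preimage ?linear0 ?rpred0 //.
by move=> fx fy; rewrite linearP rpredD ?rpredZ.
Qed.

HB.instance Definition _ :=
  GRing.isSubmodClosed.Build k V linear_preimage linear_preimage_submod_closed.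

End LinearPreimage.

Lemma card_le_lt_trans (T U K : Type) (A : set T) (B : set U) (C : set K) :
  (A #<= B)%card -> card_lt B C -> card_lt A C.
Proof.
move=> AB [BC nBC]; split; first exact: card_le_trans BC.
rewrite card_eq_le => /andP[_ CA]; apply: nBC.
by rewrite card_eq_le BC (card_le_trans CA).
Qed.

Lemma codim_lt_preimage (k : fieldType) (V V' : lmodType k)
    (f : {linear V -> V'}) (W : submodClosed V') (K : Type) (kappa : set K) :
  dim_lt V' kappa -> codim_lt (linear_preimage f W) kappa.
Proof.
move=> [S [_ spanS] S_lt].
have [|v fv0|B basisB BS] :=
    subquotient_basis (f := f) (p := quotient_proj (linear_preimage f W))
      _ _ spanS.
- exact: quotient_proj_surj.
- by apply: quotient_proj_eq0; rewrite mem_linear_preimage fv0 rpred0.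
- by exists B => //; apply: card_le_lt_trans S_lt.
Qed.

(** * Continuity of linear maps *)

Lemma dtvs_translation_continuous (k : fieldType) (V : discreteTvsType k)
  (a : V) : continuous (fun x : V => a + x).
Proof.
move=> x; have ax : (fun y : V => (a, y)) y @[y --> x] --> nbhs (a, x).
  by apply: cvg_pair; [exact: cvg_cst | exact: cvg_id].
move=> U /(@dtvs_add_continuous k V (a, x))/ax; exact.
Qed.

(** Translations by [f x] in [V'] and by [- x] in [V] carry continuity from [0] to [x]. *)
Lemma linear_continuous_at0 (k : fieldType) (V V' : discreteTvsType k)
    (f : {linear V -> V'}) :
  (forall U : set V', nbhs 0 U -> nbhs 0 (f @^-1` U)) -> continuous f.
Proof.
move=> f0 x U Ufx.
have U0 : nbhs 0 [set y | U (f x + y)].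
  by apply: (@dtvs_translation_continuous k V' (f x) 0 U); rewrite /= addr0.
have : nbhs x [set y | U (f x + f (- x + y))].
  apply: (@dtvs_translation_continuous k V (- x) x
    [set z | U (f x + f z)]).
  by rewrite /= addNr; apply: f0 U0.
apply: filterS => y /=.
by rewrite linearD linearN addrA subrr add0r.
Qed.

Theorem proposition2p13 (k : fieldType) (V V' : discreteTvsType k)
    (K : Type) (kappa : set K)
    (kappa_card : (kappa #= [set: unit])%card \/ ([set: nat] #<= kappa)%card)
    (linV : linear_topology V) (linV' : linear_topology V')
    (codimV : codim_topology V kappa)
    (dimV' : dim_lt V' kappa) :
  CLinHom V V' = LinHom V V'.
Proof.
apply/seteqP; split=> [f []//|f lin_f]; split=> //.
pose g : {linear V -> V'} :=
  HB.pack f (GRing.isLinear.Build k V V' *:%R f lin_f).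
apply: (@linear_continuous_at0 k V V' g); rewrite linV'.
(* The sets whose preimage is a neighborhood of [0] form a filter, so it suffices to test the
   generating subspaces. *)
apply: (@smallest_sub _ Filter _ [set U | nbhs 0 (g @^-1` U)]).
move=> _ [W _ <-]; rewrite /= codimV; apply: sub_gen_smallest.
by exists (linear_preimage g W : submodClosed V) => //;
  apply: codim_lt_preimage.
Qed.
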